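(* The function $g$ is Lipschitz continuous, and for all $z\in\mathbb{R}^4$ and $s\ge 0$, $$g(z,s)<0\quad\Longleftrightarrow\quad \forall i,j:\ X_j(z)\notin\mathcal{O}_i(s)\ \text{ and }\ \forall i,j:\ X^i_j(s)\notin\mathcal{V}(z),$$ where $i$ ranges over $1,\dots,k$ and $j$ over $1,\dots,4$.
   Context: For $\psi\in\mathbb{R}$ let $R_\psi=\begin{pmatrix}\cos\psi&-\sin\psi\\ \sin\psi&\cos\psi\end{pmatrix}$, and for $j=1,\dots,4$ let $T_j=\begin{pmatrix}(-1)^{j-1}&0\\0&(-1)^{\lfloor (j-1)/2\rfloor}\end{pmatrix}$. Vehicle: fix half-lengths $\ell=(\ell_x,\ell_y)^T$ with $\ell_x,\ell_y>0$. For a state $z=(x,y,\psi,v)\in\mathbb{R}^4$, with $X=(x,y)^T$, the vehicle is the closed rectangle $\mathcal{V}(z)=X+R_\psi([-\ell_x,\ell_x]\times[-\ell_y,\ell_y])$, with corners $X_j(z)=X+R_\psi T_j\ell$, $1\le j\le 4$. Obstacles: let $k\ge 1$. For $1\le i\le k$, obstacle $i$ has half-lengths $\ell^i=(\ell^i_x,\ell^i_y)^T$ with positive entries, center $X^i(s)\in\mathbb{R}^2$ and orientation $\psi_i(s)\in\mathbb{R}$ at time $s\ge 0$, where $X^i,\psi_i$ are Lipschitz continuous functions of time. It is the closed rectangle $\mathcal{O}_i(s)=X^i(s)+R_{\psi_i(s)}([-\ell^i_x,\ell^i_x]\times[-\ell^i_y,\ell^i_y])$, with corners $X^i_j(s)=X^i(s)+R_{\psi_i(s)}T_j\ell^i$,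 $1\le j\le4$. For a half-length vector $\lambda=(\lambda_x,\lambda_y)$ and $Y=(y_1,y_2)^T\in\mathbb{R}^2$ let $d_\lambda(Y):=\min(\lambda_x-|y_1|,\lambda_y-|y_2|)$. For $Y\in\mathbb{R}^2$ let $d_{\mathcal{V}(z)}(Y):=d_\ell(R_{-\psi}(Y-X))$ and $d_{\mathcal{O}_i(s)}(Y):=d_{\ell^i}(R_{-\psi_i(s)}(Y-X^i(s)))$. The obstacle function $g:\mathbb{R}^4\times[0,\infty)\to\mathbb{R}$ is $$g(z,s):=\max_{1\le i\le k}\max\Big(\max_{1\le j\le4}d_{\mathcal{V}(z)}(X^i_j(s)),\ \max_{1\le j\le4}d_{\mathcal{O}_i(s)}(X_j(z))\Big).$$
   Formalization: ''g is Lipschitz continuous'' is proved as Lipschitz on every bounded subset of R^4×[0,∞): no single global constant exists, since turning the vehicle by π/4 at distance r from a fixed obstacle changes g by an amount growing linearly in r. *)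

(* Defs.v *)
From HB Require Import structures.
From mathcomp Require Import all_boot all_order all_algebra.
From mathcomp Require Import all_classical all_reals all_analysis.

Set Implicit Arguments.
Unset Strict Implicit.
Unset Printing Implicit Defensive.

Import Order.TTheory GRing.Theory Num.Theory.
Import numFieldNormedType.Exports.

Local Open Scope classical_set_scope.
Local Open Scope ring_scope.

Definition col2 (R : realType) (a b : R) : 'cV[R]_2 :=
  \col_(i < 2) (if i == 0 then a else b).

Definition mx2 (R : realType) (a b c d : R) : 'M[R]_2 :=
  \matrix_(i < 2, j < 2)
    (if i == 0 then (if j == 0 then a else b) else (if j == 0 then c else d)).

Definition rot (R : realType) (psi : R) : 'M[R]_2 :=
  mx2 (cos psi) (- sin psi) (sin psi) (cos psi).

(* The index j : 'I_4 starts at 0, so this is the matrix T_(j+1). *)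
Definition corner_sign (R : realType) (j : 'I_4) : 'M[R]_2 :=
  mx2 ((-1) ^+ j) 0 0 ((-1) ^+ j./2).

Definition box (R : realType) (lam : 'cV[R]_2) : set 'cV[R]_2 :=
  [set Y | - lam 0 0 <= Y 0 0 <= lam 0 0 /\ - lam 1 0 <= Y 1 0 <= lam 1 0].

Definition rect (R : realType) (lam X : 'cV[R]_2) (psi : R) : set 'cV[R]_2 :=
  [set X + rot psi *m Y | Y in box lam].

Definition rect_corner (R : realType) (lam X : 'cV[R]_2) (psi : R) (j : 'I_4) :
    'cV[R]_2 :=
  X + rot psi *m (corner_sign R j *m lam).

Definition box_dist (R : realType) (lam Y : 'cV[R]_2) : R :=
  Num.min (lam 0 0 - `|Y 0 0|) (lam 1 0 - `|Y 1 0|).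

Definition rect_dist (R : realType) (lam X : 'cV[R]_2) (psi : R)
    (Y : 'cV[R]_2) : R :=
  box_dist lam (rot (- psi) *m (Y - X)).

(* A state is z = (x, y, psi, v); the speed v does not enter the geometry. *)
Definition state_pos (R : realType) (z : 'rV[R]_4) : 'cV[R]_2 :=
  col2 (z 0 0) (z 0 1).

Definition state_angle (R : realType) (z : 'rV[R]_4) : R := z 0 2.

Definition vehicle (R : realType) (l : 'cV[R]_2) (z : 'rV[R]_4) :
    set 'cV[R]_2 :=
  rect l (state_pos z) (state_angle z).

Definition vehicle_corner (R : realType) (l : 'cV[R]_2) (z : 'rV[R]_4)
    (j : 'I_4) : 'cV[R]_2 :=
  rect_corner l (state_pos z) (state_angle z) j.

Definition vehicle_dist (R : realType) (l : 'cV[R]_2) (z : 'rV[R]_4)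
    (Y : 'cV[R]_2) : R :=
  rect_dist l (state_pos z) (state_angle z) Y.

(* [lo i], [Xo i s], [psio i s] are the half-lengths of obstacle i and its
   center and orientation at time s. *)
Definition obstacle (R : realType) (k : nat) (lo : 'I_k -> 'cV[R]_2)
    (Xo : 'I_k -> R -> 'cV[R]_2) (psio : 'I_k -> R -> R) (i : 'I_k) (s : R) :
    set 'cV[R]_2 :=
  rect (lo i) (Xo i s) (psio i s).

Definition obstacle_corner (R : realType) (k : nat) (lo : 'I_k -> 'cV[R]_2)
    (Xo : 'I_k -> R -> 'cV[R]_2) (psio : 'I_k -> R -> R) (i : 'I_k) (s : R)
    (j : 'I_4) : 'cV[R]_2 :=
  rect_corner (lo i) (Xo i s) (psio i s) j.

Definition obstacle_dist (R : realType) (k : nat) (lo : 'I_k -> 'cV[R]_2)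
    (Xo : 'I_k -> R -> 'cV[R]_2) (psio : 'I_k -> R -> R) (i : 'I_k) (s : R)
    (Y : 'cV[R]_2) : R :=
  rect_dist (lo i) (Xo i s) (psio i s) Y.

(* Maximum of a nonempty finite family. Max has no neutral element in R, so the
   iteration is seeded with one of the terms, [F i0], which leaves the maximum
   unchanged. *)
Definition fmax (R : realType) (I : finType) (i0 : I) (F : I -> R) : R :=
  \big[Num.max/F i0]_(i : I) F i.

(* k >= 1 is needed for the outer maximum to make sense; [k_gt0] only serves to
   exhibit an index. Times are s >= 0; the values for s < 0 are irrelevant. *)
Definition obstacle_fun (R : realType) (k : nat) (k_gt0 : (0 < k)%N)
    (l : 'cV[R]_2) (lo : 'I_k -> 'cV[R]_2) (Xo : 'I_k -> R -> 'cV[R]_2)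
    (psio : 'I_k -> R -> R) (z : 'rV[R]_4) (s : R) : R :=
  fmax (Ordinal k_gt0) (fun i : 'I_k =>
    Num.max
      (fmax ord0 (fun j : 'I_4 =>
         vehicle_dist l z (obstacle_corner lo Xo psio i s j)))
      (fmax ord0 (fun j : 'I_4 =>
         obstacle_dist lo Xo psio i s (vehicle_corner l z j)))).

(* Local Lipschitz continuity, in the form "Lipschitz on bounded subsets of the
   domain". A single global constant is impossible for [obstacle_fun]: far from
   the obstacles its derivative in the vehicle orientation grows linearly with
   the distance to them. *)
Definition lipschitz_on_bounded (R : realType) (V W : normedModType R)
    (D : set V) (f : V -> W) : Prop :=
  forall B : set V, bounded_set B -> [lipschitz f x | x in B `&` D].

(* Main.v *)
(* On a bounded set the product of two bounded Lipschitz functions is again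
   bounded and Lipschitz, and so are sums, maxima, minima and compositions with
   a 1-Lipschitz function such as cos, sin or the absolute value. The function g
   is built by these operations from the coordinates of z and from the centers
   and orientations of the obstacles. Its sign is read off corner by corner:
   d(Y) >= 0 means that the rotated point lies in the box, and R_psi inverts
   R_(-psi). *)
Require Import Defs.
From HB Require Import structures.
From mathcomp Require Import all_boot all_order all_algebra.
From mathcomp Require Import all_classical all_reals all_analysis.
From mathcomp Require Import ring lra.
Import Order.TTheory GRing.Theory Num.Theory.
Import numFieldNormedType.Exports.
Local Open Scope classical_set_scope.
Local Open Scope ring_scope.

(** Boundedness is built in because Lipschitz functions alone are not stable under products. A
    single [K] serves as bound and as Lipschitz constant, and values are real, so matrices are
    handled entry by entry. *)
Definition bounded_lipschitz_in {R : realType} {V : normedModType R}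
    (S : set V) (f : V -> R) : Prop :=
  exists2 K, 0 <= K & forall x y, S x -> S y ->
    `|f x| <= K /\ `|f x - f y| <= K * `|x - y|.

(** * Elementary Lipschitz estimates *)

Lemma le_abs_sub_of_derive_le1 {R : realType} (f df : R -> R) :
  (forall x : R, is_derive x 1 f (df x)) -> (forall x, `|df x| <= 1) ->
  forall x y, `|f x - f y| <= `|x - y|.
Proof.
move=> fdf df1 x y; wlog le_xy : x y / x <= y => [hw|].
  case: (leP x y) => [/hw //|/ltW/hw]; by rewrite distrC (distrC y).
have [c _ fE] : exists2 c, c \in `[x, y] & f y - f x = df c * (y - x).
  apply: MVT_segment => //; apply: continuous_subspaceT => z.
  exact/differentiable_continuous/derivable1_diffP/(@ex_derive _ _ _ _ _ _ _ (fdf z)).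
by rewrite distrC (distrC x) fE normrM ler_piMl.
Qed.

Lemma abs_cosB_le {R : realType} (x y : R) : `|cos x - cos y| <= `|x - y|.
Proof.
apply: (@le_abs_sub_of_derive_le1 _ _ (fun t => - sin t)) => t.
by rewrite normrN sin_max.
Qed.

Lemma abs_sinB_le {R : realType} (x y : R) : `|sin x - sin y| <= `|x - y|.
Proof.
by apply: (@le_abs_sub_of_derive_le1 _ _ cos) => t; exact: cos_max.
Qed.

Lemma norm_entry_le {R : realType} {m n : nat} (A : 'M[R]_(m, n)) i j :
  `|A i j| <= `|A|.
Proof.
by rewrite [leRHS]/Num.Def.normr /= mx_normrE; apply/bigmax_geP; right => /=; exists (i, j).
Qed.

(** The library notation asks for the estimate with all sufficiently large constants; this trades it
    for one nonnegative constant. From a threshold [M], the value [max 0 M + 1] is nonnegative and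
    strictly above [M]. *)
Lemma lipschitz_on_setP {R : realType} {V W : normedModType R} (S : set V)
    (f : V -> W) :
  [lipschitz f x | x in S] <->
  exists2 K, 0 <= K & forall x y, S x -> S y -> `|f x - f y| <= K * `|x - y|.
Proof.
split=> [[M [_ HM]]|[K K0 HK]].
  exists (Num.max 0 M + 1); first by rewrite addr_ge0// le_max lexx.
  move=> x y Sx Sy; apply: (HM (Num.max 0 M + 1) _ (x, y)) => //.
  by rewrite ltr_pwDr// le_max lexx orbT.
exists K; split; first exact: num_real.
move=> M KM [x y] [/= Sx Sy]; apply: (le_trans (HK _ _ Sx Sy)).
by rewrite ler_wpM2r// ltW.
Qed.

Lemma bounded_lipschitz_in_lipschitz {R : realType} {V : normedModType R}
    (S : set V) (f : V -> R) :
  bounded_lipschitz_in S f -> [lipschitz f x | x in S].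
Proof.
move=> [K K0 HK]; apply/lipschitz_on_setP; exists K => // x y Sx Sy.
by have [] := HK x y Sx Sy.
Qed.

Lemma lipschitz_bounded_lipschitz_in {R : realType} {V : normedModType R}
    (S : set V) (f : V -> R) :
  bounded_set S -> [lipschitz f x | x in S] -> bounded_lipschitz_in S f.
Proof.
move=> [M [_ HM]] /lipschitz_on_setP [K K0 HK].
(* The bound on [f] is measured from a base point [a] of [S]; on the empty set the constant 0 works
   vacuously. *)
have [->|/set0P [a Sa]] := eqVneq S set0; first by exists 0.
pose N := Num.max 0 M + 1.
have N0 : 0 <= N by rewrite addr_ge0// le_max lexx.
have SN x : S x -> `|x| <= N.
  by apply: HM; rewrite ltr_pwDr// le_max lexx orbT.
(* Two points of [S] are at distance at most [N + N], so the second summand bounds [f]; the first is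
   its Lipschitz constant. *)
exists (K + (`|f a| + K * (N + N))).
  by rewrite !addr_ge0// mulr_ge0// addr_ge0.
move=> x y Sx Sy; split.
  apply: ler_wpDl => //; rewrite -[f x](subrK (f a)) addrC.
  apply: (le_trans (ler_normD _ _)); rewrite lerD2l.
  apply: (le_trans (HK _ _ Sx Sa)); rewrite ler_wpM2l//.
  by apply: (le_trans (ler_normB _ _)); apply: lerD; exact: SN.
apply: (le_trans (HK _ _ Sx Sy)); rewrite ler_wpM2r// lerDl.
by rewrite addr_ge0// mulr_ge0// addr_ge0.
Qed.

(** * Closure properties of bounded Lipschitz functions *)

Section BoundedLipschitz.
Context {R : realType} {V : normedModType R} (S : set V).
Local Notation bl := (bounded_lipschitz_in S).
Implicit Types f g : V -> R.

Lemma bounded_lipschitz_in_cst (c : R) : bl (fun=> c).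
Proof.
by exists `|c| => // x y _ _; rewrite subrr normr0 mulr_ge0.
Qed.

Lemma bounded_lipschitz_inD f g : bl f -> bl g -> bl (fun x => f x + g x).
Proof.
move=> [K K0 HK] [L L0 HL]; exists (K + L); first exact: addr_ge0.
move=> x y Sx Sy; have [fK fxy] := HK _ _ Sx Sy; have [gL gxy] := HL _ _ Sx Sy.
split; first exact: le_trans (ler_normD _ _) (lerD _ _).
by rewrite opprD addrACA mulrDl; apply: le_trans (ler_normD _ _) (lerD _ _).
Qed.

Lemma bounded_lipschitz_inM f g : bl f -> bl g -> bl (fun x => f x * g x).
Proof.
(* The first [K * L] bounds the product; the other two bound the two terms of the splitting of its
   increment below. *)
move=> [K K0 HK] [L L0 HL]; exists (K * L + (K * L + K * L)).
  by rewrite !addr_ge0// mulr_ge0.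
move=> x y Sx Sy; have [fK fxy] := HK _ _ Sx Sy; have [gL gxy] := HL _ _ Sx Sy.
have [gL' _] := HL _ _ Sy Sx.
split.
  by rewrite normrM ler_wpDr ?ler_pM// addr_ge0// mulr_ge0.
have -> : f x * g x - f y * g y = f x * (g x - g y) + (f x - f y) * g y by ring.
apply: (le_trans (ler_normD _ _)); rewrite !normrM mulrDl.
apply: ler_wpDl; first by rewrite !mulr_ge0.
rewrite mulrDl; apply: lerD; first by rewrite -mulrA ler_pM.
by rewrite mulrAC ler_pM.
Qed.

Lemma bounded_lipschitz_in_comp f (h : R -> R) :
  (forall x y, `|h x - h y| <= `|x - y|) -> bl f -> bl (fun x => h (f x)).
Proof.
(* Comparing with the value at 0 gives |h(t)| <= |h(0)| + |t|. *)
move=> h1 [K K0 HK]; exists (`|h 0| + K); first by rewrite addr_ge0.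
move=> x y Sx Sy; have [fK fxy] := HK _ _ Sx Sy; split.
  rewrite -[h (f x)](subrK (h 0)) addrC; apply: (le_trans (ler_normD _ _)).
  by rewrite lerD2l; apply: (le_trans (h1 _ _)); rewrite subr0.
by apply: (le_trans (h1 _ _)); rewrite mulrDl; apply: ler_wpDl => //; exact: mulr_ge0.
Qed.

Lemma bounded_lipschitz_inN f : bl f -> bl (fun x => - f x).
Proof.
by apply: (@bounded_lipschitz_in_comp _ -%R) => x y; rewrite -opprD normrN.
Qed.

Lemma bounded_lipschitz_in_norm f : bl f -> bl (fun x => `|f x|).
Proof.
by apply: (@bounded_lipschitz_in_comp _ Num.norm); exact: ler_dist_dist.
Qed.

Lemma bounded_lipschitz_inB f g : bl f -> bl g -> bl (fun x => f x - g x).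
Proof.
by move=> bf bg; apply: bounded_lipschitz_inD => //; exact: bounded_lipschitz_inN.
Qed.

(** Since max(a, b) = (a + b + |a - b|) / 2, sums, absolute values and a constant factor suffice;
    the minimum is the same with a minus sign. *)
Lemma bounded_lipschitz_in_max f g :
  bl f -> bl g -> bl (fun x => Num.max (f x) (g x)).
Proof.
move=> bf bg; under eq_fun do rewrite maxr_absE.
apply: bounded_lipschitz_inM (bounded_lipschitz_in_cst _).
apply: bounded_lipschitz_inD; first exact: bounded_lipschitz_inD.
by apply/bounded_lipschitz_in_norm/bounded_lipschitz_inB.
Qed.

Lemma bounded_lipschitz_in_min f g :
  bl f -> bl g -> bl (fun x => Num.min (f x) (g x)).
Proof.
move=> bf bg; under eq_fun do rewrite minr_absE.
apply: bounded_lipschitz_inM (bounded_lipschitz_in_cst _).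
apply: bounded_lipschitz_inB; first exact: bounded_lipschitz_inD.
by apply/bounded_lipschitz_in_norm/bounded_lipschitz_inB.
Qed.

Lemma bounded_lipschitz_in_sum (I : finType) (F : I -> V -> R) :
  (forall i, bl (F i)) -> bl (fun x => \sum_i F i x).
Proof.
move=> bF; elim: (index_enum I) => [|i r ih].
  by under eq_fun do rewrite big_nil; exact: bounded_lipschitz_in_cst.
by under eq_fun do rewrite big_cons; exact: bounded_lipschitz_inD.
Qed.

Lemma bounded_lipschitz_in_fmax (I : finType) (i0 : I) (F : I -> V -> R) :
  (forall i, bl (F i)) -> bl (fun x => fmax i0 (fun i => F i x)).
Proof.
move=> bF; rewrite /fmax; elim: (index_enum I) => [|i r ih].
  (* The empty list leaves the seed [F i0], itself a member of the family. *)
  by under eq_fun do rewrite big_nil; exact: bF.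
by under eq_fun do rewrite big_cons; exact: bounded_lipschitz_in_max.
Qed.

Lemma bounded_lipschitz_in_mulmx (m n p : nat) (A : V -> 'M[R]_(m, n))
    (B : V -> 'M[R]_(n, p)) :
  (forall i j, bl (fun x => A x i j)) -> (forall i j, bl (fun x => B x i j)) ->
  forall i j, bl (fun x => (A x *m B x) i j).
Proof.
move=> bA bB i j; under eq_fun do rewrite mxE.
by apply: bounded_lipschitz_in_sum => a; exact: bounded_lipschitz_inM.
Qed.

Lemma bounded_lipschitz_in_rot (psi : V -> R) :
  bl psi -> forall i j, bl (fun x => Defs.rot (psi x) i j).
Proof.
move=> bpsi i j; under eq_fun do rewrite mxE.
have bc : bl (fun x => cos (psi x)).
  exact: bounded_lipschitz_in_comp abs_cosB_le bpsi.
have bs : bl (fun x => sin (psi x)).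
  exact: bounded_lipschitz_in_comp abs_sinB_le bpsi.
by case: (i == 0); case: (j == 0) => //; exact: bounded_lipschitz_inN.
Qed.

Lemma bounded_lipschitz_in_rect_corner (lam : 'cV[R]_2) (X : V -> 'cV[R]_2)
    (psi : V -> R) (j : 'I_4) :
  (forall a b, bl (fun x => X x a b)) -> bl psi ->
  forall a b, bl (fun x => rect_corner lam (X x) (psi x) j a b).
Proof.
move=> bX bpsi a b; under eq_fun do rewrite mxE.
apply: bounded_lipschitz_inD => //; apply: bounded_lipschitz_in_mulmx.
  exact: bounded_lipschitz_in_rot.
by move=> ? ?; exact: bounded_lipschitz_in_cst.
Qed.

Lemma bounded_lipschitz_in_rect_dist (lam : 'cV[R]_2) (X : V -> 'cV[R]_2)
    (psi : V -> R) (Y : V -> 'cV[R]_2) :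
  (forall a b, bl (fun x => X x a b)) -> bl psi ->
  (forall a b, bl (fun x => Y x a b)) ->
  bl (fun x => rect_dist lam (X x) (psi x) (Y x)).
Proof.
move=> bX bpsi bY.
have bZ a b : bl (fun x => (Defs.rot (- psi x) *m (Y x - X x)) a b).
  apply: bounded_lipschitz_in_mulmx => [|i j].
    exact/bounded_lipschitz_in_rot/bounded_lipschitz_inN.
  by under eq_fun do rewrite 2!mxE; exact: bounded_lipschitz_inB.
apply: bounded_lipschitz_in_min; apply: bounded_lipschitz_inB.
- exact: bounded_lipschitz_in_cst.
- exact: bounded_lipschitz_in_norm.
- exact: bounded_lipschitz_in_cst.
- exact: bounded_lipschitz_in_norm.
Qed.

End BoundedLipschitz.

(** * Signs of the distance functions and of finite maxima *)

Lemma rot_mulNK {R : realType} (psi : R) : Defs.rot psi *m Defs.rot (- psi) = 1%:M.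
Proof.
apply/matrixP => i j; rewrite !mxE !big_ord_recl big_ord0 !mxE /= cosN sinN.
have := cos2Dsin2 psi; rewrite !expr2 => h.
by case: i => [[|[|//]] ?]; case: j => [[|[|//]] ?]; rewrite /= ?mulr1n ?mulr0n; lra.
Qed.

Lemma box_dist_ge0 {R : realType} (lam Y : 'cV[R]_2) :
  (0 <= box_dist lam Y) <-> box lam Y.
Proof.
rewrite /box_dist /box /= le_min !subr_ge0 !ler_norml.
by split=> /andP.
Qed.

Lemma rect_dist_lt0 {R : realType} (lam X : 'cV[R]_2) (psi : R) (Y : 'cV[R]_2) :
  rect_dist lam X psi Y < 0 <-> ~ rect lam X psi Y.
Proof.
rewrite ltNge; have -> : rect lam X psi Y <-> 0 <= rect_dist lam X psi Y.
  rewrite box_dist_ge0; split=> [[Z bZ <-]|bY].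
    (* Writing the second [psi] as [- - psi] turns [rot_mulNK] into the cancellation in the opposite
       order. *)
    by rewrite addrC addKr mulmxA -{2}[psi]opprK rot_mulNK mul1mx.
  exists (Defs.rot (- psi) *m (Y - X)) => //.
  by rewrite mulmxA rot_mulNK mul1mx addrC subrK.
by split=> /negP.
Qed.

Lemma fmax_lt {R : realType} (I : finType) (i0 : I) (F : I -> R) (c : R) :
  fmax i0 F < c <-> forall i, F i < c.
Proof.
split=> [/bigmax_ltP [_ H] i|H]; first exact: H.
(* The seed must also lie below [c]; this is the hypothesis at [i0]. *)
by apply/bigmax_ltP.
Qed.

Theorem lemma4p2 (R : realType) (k : nat) (k_gt0 : (0 < k)%N)
    (l : 'cV[R]_2) (l_gt0 : forall a : 'I_2, 0 < l a 0)
    (lo : 'I_k -> 'cV[R]_2)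
    (lo_gt0 : forall (i : 'I_k) (a : 'I_2), 0 < lo i a 0)
    (Xo : 'I_k -> R -> 'cV[R]_2)
    (Xo_lip : forall i : 'I_k, [lipschitz Xo i s | s in [set s : R | 0 <= s]])
    (psio : 'I_k -> R -> R)
    (psio_lip : forall i : 'I_k,
      [lipschitz psio i s | s in [set s : R | 0 <= s]]) :
  lipschitz_on_bounded [set p : 'rV[R]_4 * R | 0 <= p.2]
    (fun p : 'rV[R]_4 * R => obstacle_fun k_gt0 l lo Xo psio p.1 p.2) /\
  (forall (z : 'rV[R]_4) (s : R), 0 <= s ->
    obstacle_fun k_gt0 l lo Xo psio z s < 0 <->
    (forall (i : 'I_k) (j : 'I_4),
       ~ obstacle lo Xo psio i s (vehicle_corner l z j)) /\
    (forall (i : 'I_k) (j : 'I_4),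
       ~ vehicle l z (obstacle_corner lo Xo psio i s j))).
Proof.
(* The sign equivalence comes first: a maximum is negative exactly when every term is, and each term
   is one corner condition. *)
split=> [B bB|z s _]; last first.
  split=> [/fmax_lt g0|[notO notV]].
    split=> i j; apply/rect_dist_lt0; move: (g0 i); rewrite gt_max.
      by case/andP=> _ /fmax_lt /(_ j).
    by case/andP=> /fmax_lt /(_ j).
  apply/fmax_lt => i; rewrite gt_max; apply/andP; split; apply/fmax_lt => j.
    exact/rect_dist_lt0/notV.
  exact/rect_dist_lt0/notO.
apply: bounded_lipschitz_in_lipschitz; set S := _ `&` _.
have bS : bounded_set S.
  by case: bB => M [Mr HM]; exists M; split=> // x Mx p [Bp _]; exact: HM Bp.
(* The product carries the max norm, so both projections are 1-Lipschitz. *)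
have le1 (p : 'rV[R]_4 * R) : `|p.1| <= `|p| by rewrite prod_normE le_max lexx.
have le2 (p : 'rV[R]_4 * R) : `|p.2| <= `|p|.
  by rewrite prod_normE le_max lexx orbT.
have bz a : bounded_lipschitz_in S (fun p : 'rV[R]_4 * R => p.1 0 a).
  apply: lipschitz_bounded_lipschitz_in => //; apply/lipschitz_on_setP.
  exists 1 => // p q _ _; rewrite mul1r.
  by apply: le_trans (le1 (p - q)); have := norm_entry_le (p - q).1 0 a; rewrite !mxE.
(* Obstacle data are Lipschitz only for nonnegative times, which is why [S] keeps the domain
   constraint. The map [h] reads a real number off the data: an entry of a center, or an orientation
   itself. *)
have bt (W : normedModType R) (f : R -> W) (h : W -> R) :
    (forall u v, `|h u - h v| <= `|u - v|) ->
    [lipschitz f s | s in [set s : R | 0 <= s]] ->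
    bounded_lipschitz_in S (fun p : 'rV[R]_4 * R => h (f p.2)).
  move=> h1 /lipschitz_on_setP [K K0 HK].
  apply: lipschitz_bounded_lipschitz_in => //; apply/lipschitz_on_setP.
  exists K => // p q [_ p0] [_ q0]; apply: (le_trans (h1 _ _)).
  apply: (le_trans (HK _ _ p0 q0)); rewrite ler_wpM2l//.
  exact: le_trans (le2 (p - q)).
have bX i a b : bounded_lipschitz_in S (fun p : 'rV[R]_4 * R => Xo i p.2 a b).
  apply: (bt _ (Xo i) (fun Y : 'cV[R]_2 => Y a b)) (Xo_lip i) => u v.
  by have := norm_entry_le (u - v) a b; rewrite !mxE.
have bpsi i : bounded_lipschitz_in S (fun p : 'rV[R]_4 * R => psio i p.2).
  exact: (bt _ (psio i) id) (psio_lip i).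
have bpos a b :
    bounded_lipschitz_in S (fun p : 'rV[R]_4 * R => state_pos p.1 a b).
  by under eq_fun do rewrite mxE; case: (a == 0); exact: bz.
(* Both halves of the maximum have one shape: the distance function of a moving rectangle evaluated
   at a corner of another moving rectangle. *)
apply: bounded_lipschitz_in_fmax => i; apply: bounded_lipschitz_in_max;
  apply: bounded_lipschitz_in_fmax => j; apply: bounded_lipschitz_in_rect_dist;
  do ?[exact: bz | exact: bX | exact: bpsi | exact: bpos];
  apply: bounded_lipschitz_in_rect_corner;
  do ?[exact: bz | exact: bX | exact: bpsi | exact: bpos].
Qed.
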